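(* The group $\mathrm{SL}_3(\mathbb{Z})$ contains a non-split sharply 2-transitive subgroup; that is, there is a subgroup $G\leq \mathrm{SL}_3(\mathbb{Z})$ such that $G$ is a sharply 2-transitive group and $G$ has no non-trivial normal abelian subgroup.
   Context: An action of a group $G$ on a set $X$ with $|X|\geq 2$ is sharply 2-transitive if, for any two pairs $(x_1,x_2)$ and $(y_1,y_2)$ of distinct elements of $X$, there exists a unique $g\in G$ with $g x_1=y_1$ and $g x_2=y_2$. A group $G$ is called sharply 2-transitive if there exists a set $X$ with a sharply 2-transitive action of $G$ on $X$ (for a subgroup of $\mathrm{SL}_3(\mathbb{Z})$, $X$ is an arbitrary abstract set, unrelated to the linear action). A sharply 2-transitive group is called split if it contains a non-trivial normal abelian subgroup, and non-split otherwise. *)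

(* Defs.v *)
From HB Require Import structures.
From mathcomp Require Import all_boot all_order all_algebra.
From mathcomp Require Import classical_sets.

Set Implicit Arguments.
Unset Strict Implicit.
Unset Printing Implicit Defensive.

Import GRing.Theory.
Local Open Scope ring_scope.

Section SpecialLinear.
Variables (R : comNzRingType) (n : nat).

Record special_linear := SpecialLinear {
  slval :> 'M[R]_n;
  _ : \det slval == 1 }.

HB.instance Definition _ := [isSub for slval].
HB.instance Definition _ := [Choice of special_linear by <:].

Implicit Types A B : special_linear.

Lemma det_slval A : \det (slval A) = 1. Proof. exact/eqP/(valP A). Qed.

Fact sl_one_subproof : \det (1%:M : 'M[R]_n) == 1.
Proof. by rewrite det1. Qed.

Fact sl_mul_subproof A B : \det (slval A *m slval B) == 1.
Proof. by rewrite det_mulmx !det_slval mulr1. Qed.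

(* The adjugate is a two-sided inverse because the determinant is 1; this works
   over any commutative ring. *)
Fact sl_inv_subproof A : \det (\adj (slval A)) == 1.
Proof.
by rewrite -[\det _]mul1r -{1}(det_slval A) -det_mulmx mul_mx_adj det_slval det1.
Qed.

Definition sl_one := SpecialLinear sl_one_subproof.
Definition sl_mul A B := SpecialLinear (sl_mul_subproof A B).
Definition sl_inv A := SpecialLinear (sl_inv_subproof A).

Fact sl_mulA : associative sl_mul.
Proof. by move=> A B C; apply/val_inj/mulmxA. Qed.
Fact sl_mul1 : left_id sl_one sl_mul.
Proof. by move=> A; apply/val_inj/mul1mx. Qed.
Fact sl_mulr1 : right_id sl_one sl_mul.
Proof. by move=> A; apply/val_inj/mulmx1. Qed.
Fact sl_mulV : left_inverse sl_one sl_inv sl_mul.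
Proof. by move=> A; apply/val_inj; rewrite /= mul_adj_mx det_slval. Qed.
Fact sl_mulrV : right_inverse sl_one sl_inv sl_mul.
Proof. by move=> A; apply/val_inj; rewrite /= mul_mx_adj det_slval. Qed.

HB.instance Definition _ :=
  isGroup.Build special_linear sl_mulA sl_mul1 sl_mulr1 sl_mulV sl_mulrV.

End SpecialLinear.

Notation "''SL_' n [ R ]" := (special_linear R n)
  (at level 8, n at level 2, format "''SL_' n [ R ]") : type_scope.

Local Open Scope group_scope.

Definition is_group_action (G : groupType) (X : Type) (act : G -> X -> X) :=
  (forall x, act 1 x = x) /\
  (forall g h x, act (g * h) x = act g (act h x)).

Definition sharply_2_transitive_action
    (G : groupType) (X : Type) (act : G -> X -> X) :=
  [/\ is_group_action act,
      exists x y : X, x <> y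
    & forall x1 x2 y1 y2 : X, x1 <> x2 -> y1 <> y2 ->
        exists! g : G, act g x1 = y1 /\ act g x2 = y2].

Definition sharply_2_transitive (G : groupType) :=
  exists (X : Type) (act : G -> X -> X), sharply_2_transitive_action act.

(* N ranges over arbitrary (Prop-valued) subsets, not only decidable ones. *)
Definition split_group (G : groupType) :=
  exists N : set G,
    [/\ group_closed [in N],
        forall x g, N x -> N (x ^ g),
        forall x y, N x -> N y -> commute x y
      & exists2 x, N x & x <> 1].

(* Main.v *)
(* Let t = diag(1,-1,-1).  Two families of transvections with ping-pong dynamics
   on Z^3, the c_i commuting with t and the d_j not, generate with t a subgroup
   of SL_3(Z) isomorphic to (<t> x F(c_0, c_1, ...)) * F(d_0, d_1, ...).  This
   group acts sharply 2-transitively on a countable set built by free completion: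
   starting from a free involution t and no other generator, one repeatedly makes
   a generator defined at one more point, sending it to a new t-orbit, or uses an
   unused generator to send a pair of points to the base pair (o, t o): some d_j
   when no element swaps the pair, some c_i when the pair is (z, t z).  A swapped
   pair always lies in the orbit of a pair (z, t z), because involutions are
   conjugate to t.  No nontrivial reduced word ever acquires two fixed points.
   Finally, in a sharply 2-transitive group where an involution t has no fixed
   point, a nontrivial abelian normal subgroup contains t, so the conjugates of t
   commute; t and its conjugate by d_0 do not. *)
From HB Require Import structures.
Require Import Defs.
From mathcomp Require Import all_boot all_order all_algebra.
From mathcomp Require Import boolp classical_sets.
From mathcomp Require Import zify ring.

Set Implicit Arguments.
Unset Strict Implicit.
Unset Printing Implicit Defensive.

Import Order.TTheory GRing.Theory Num.Theory.

(** * Words and partial actions *)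

(* (true, i) is c_i and (false, j) is d_j. *)
Definition gen := (bool * nat)%type.
(* The boolean is false for the inverse of the generator. *)
Definition letter := (gen * bool)%type.
(* (e, l) acts by t^e and then by l.  A sequence of atoms acts from left to right,
   and an element of the group is such a sequence followed by a power of t. *)
Definition atom := (bool * letter)%type.

Definition linv (l : letter) : letter := (l.1, ~~ l.2).
(** As c_i commutes with t, a c-letter cancels against its inverse even when t stands between them;
    a d-letter cancels only if no t intervenes. *)
Definition cancels (l : letter) (a : atom) :=
  (a.2 == linv l) && (l.1.1 || ~~ a.1).
Definition compat : rel atom := fun a b => ~~ cancels a.2 b.

Lemma linvK : involutive linv.
Proof. by case=> g s; rewrite /linv /= negbK. Qed.

Lemma linv_neq l : (l == linv l) = false.
Proof. by case: l => g [] /=; apply/eqP => -[]. Qed.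

Section Walks.
Variables (X : Type) (t : X -> X) (E : gen -> X -> X -> Prop).

Definition tw (b : bool) x := if b then t x else x.
Definition edge (l : letter) x y := if l.2 then E l.1 x y else E l.1 y x.

Fixpoint walk (w : seq atom) (e : bool) x y : Prop :=
  if w is a :: w' then exists2 z, edge a.2 (tw a.1 x) z & walk w' e z y
  else tw e x = y.

Inductive conn x : X -> Prop :=
| conn_refl : conn x x
| conn_t y : conn x y -> conn x (t y)
| conn_edge l y z : conn x y -> edge l y z -> conn x z.

Record valid : Prop := Valid {
  valid_tK : involutive t;
  valid_fun : forall g x y y', E g x y -> E g x y' -> y = y';
  valid_inj : forall g x x' y, E g x y -> E g x' y -> x = x';
  valid_t : forall (g : gen) x y, g.1 -> E g x y -> E g (t x) (t y) }.

Lemma edge_linv l x y : edge (linv l) x y <-> edge l y x.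
Proof. by case: l => g []. Qed.

Lemma walk_cat u v e x y :
  walk (u ++ v) e x y <-> exists2 z, walk u false x z & walk v e z y.
Proof.
elim: u x => [|a u IHu] x /=; first by split=> [?|[z -> //]]; exists x.
split=> [[z xz /IHu[z' zz' z'y]]|[z' [z xz zz'] z'y]].
  by exists z' => //; exists z.
by exists z => //; apply/IHu; exists z'.
Qed.

Lemma conn_trans x y z : conn x y -> conn y z -> conn x z.
Proof.
move=> xy; elim=> // [z' _ /conn_t //|l y' z' _ xy' yz'].
exact: conn_edge xy' yz'.
Qed.

Lemma conn_tw b x : conn x (tw b x).
Proof. by case: b; do ?constructor. Qed.

Hypothesis V : valid.

Lemma tw_tw a b x : tw a (tw b x) = tw (a (+) b) x.
Proof. by case: a b => [] [] //=; rewrite valid_tK. Qed.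

Lemma twK b : involutive (tw b).
Proof. by move=> x; rewrite tw_tw addbb. Qed.

Lemma edge_fun l x y y' : edge l x y -> edge l x y' -> y = y'.
Proof.
by case: l => g []; rewrite /edge /=; [apply: valid_fun | apply: valid_inj].
Qed.

Lemma edge_inj l x x' y : edge l x y -> edge l x' y -> x = x'.
Proof. by move=> /edge_linv xy /edge_linv; apply: edge_fun xy. Qed.

Lemma edge_tw b l x y : l.1.1 || ~~ b -> edge l x y -> edge l (tw b x) (tw b y).
Proof.
case: b => //; rewrite orbF /edge => l1.
by case: ifP => _; apply: valid_t.
Qed.

Lemma walk_tw w b e x y : walk w e x y -> walk w (b (+) e) x (tw b y).
Proof.
elim: w x => [|a w IHw] x /=; first by move=> <-; rewrite tw_tw.
by case=> z xz /IHw; exists z.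
Qed.

Lemma conn_sym x y : conn x y -> conn y x.
Proof.
elim=> [|z _ zx|l z z' _ zx zz']; first exact: conn_refl.
  apply: conn_trans zx; rewrite -{2}[z](valid_tK V).
  by apply/conn_t/conn_refl.
apply: conn_trans zx; apply: (conn_edge (l := linv l)) (conn_refl _) _.
exact/edge_linv.
Qed.

Lemma walk_conn w e x y : walk w e x y -> conn x y.
Proof.
elim: w x => [|a w IHw] x /=; first by move=> <-; apply: conn_tw.
case=> z xz /IHw; apply: conn_trans.
exact: conn_edge (conn_tw a.1 x) xz.
Qed.

(* A closed walk up to an automorphism s becomes cyclically reduced by cancelling
   its first letter against its last; the cancellation either stops at a
   nonempty cyclically reduced word or exhibits a conjugate of t. *)
Lemma cyclic_reduction (s : X -> X) u e q :
    (forall x, s (t x) = t (s x)) -> involutive s ->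
    (forall l x y, edge l x y -> edge l (s x) (s y)) ->
    sorted compat u -> walk u e q (s q) ->
  [\/ u = [::],
      exists v q', [/\ v != [::], cycle compat v, conn q q'
                     & walk v false q' (s q')]
    | exists2 q', conn q q' & t q' = s q'].
Proof.
move=> st sK sE; have stw b x : s (tw b x) = tw b (s x) by case: b.
have [n] := ubnP (size u); elim: n => // n IHn in u e q *.
case: u => [|[e1 l1] r]; first by constructor 1.
move=> /= sz_r red_r [Y qY Y_sq].
(* [a] is the first atom as seen from the end of the word read cyclically: the final power t^e
   merges with t^e1. *)
pose a := (e (+) e1, l1).
have red_a : path compat a r by case: r red_r {sz_r Y_sq}.
have [compat_a|] := boolP (compat (last a r) a).
  constructor 2; exists (a :: r), (tw e q); split=> //=.
  - by rewrite rcons_path red_a.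
  - exact: conn_tw.
  exists Y; first by rewrite tw_tw addbC addbA addbb.
  by have := walk_tw e Y_sq; rewrite addbb stw.
case/lastP: r => [|v [e2 l2]] in sz_r red_r Y_sq red_a *.
  by rewrite negbK /cancels linv_neq.
rewrite last_rcons negbK => /andP[/= /eqP el1 cancel_l].
move: Y_sq; rewrite -cats1 => /walk_cat[Z YZ [W /=] ZW We].
have eW : W = s (tw e q) by rewrite stw -We twK.
subst l1 W.
have ZY : s (tw e2 Z) = tw (e (+) e1) Y.
  have : edge (linv l2) (tw e q) (tw (e (+) e1) Y).
    have -> : tw e q = tw (e (+) e1) (tw e1 q).
      by rewrite tw_tw -addbA addbb addbF.
    exact: edge_tw.
  apply: edge_fun; rewrite -[tw e q]sK; apply: sE; exact/edge_linv.
have YsY : walk v (e2 (+) (e (+) e1)) Y (s Y).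
  have := walk_tw (e2 (+) (e (+) e1)) YZ; rewrite addbF.
  by rewrite -tw_tw -[Z](twK e2) tw_tw addbC -tw_tw -[tw e2 Z]sK ZY stw !twK.
have qconn : conn q Y by apply: conn_edge (conn_tw e1 q) qY.
have [||v0|[w [q' [? ? Yq' ?]]]|[q' Yq' tq']] := IHn v (e2 (+) (e (+) e1)) Y _ _ YsY.
- by move: sz_r; rewrite size_rcons !ltnS => /ltnW.
- move/path_sorted: red_r; rewrite -cats1.
  by case: v {YZ YsY sz_r red_a} => //= ? ?; rewrite cat_path => /andP[].
(* Here [u] consists of two mutually inverse letters. Being reduced, it is a d-letter and its
   inverse with t between them, and the cyclic cancellation forces [e (+) e1] to be false; what
   remains is exactly t, carrying [Y] to [s Y]. *)
- constructor 3; exists Y => //.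
  move: red_r YsY; rewrite v0 /= andbT /compat /cancels /= linvK eqxx /=.
  rewrite negb_or negbK => /andP[/negbTE l2F e2T].
  by move: cancel_l; rewrite l2F /= => /negbTE ->; rewrite e2T.
- constructor 2; exists w, q'; split=> //; exact: conn_trans Yq'.
- constructor 3; exists q' => //; exact: conn_trans Yq'.
Qed.

(** A pair is a word with its final exponent of t. [twist] lets the first atom, or else the final
    exponent, absorb an initial t^b; the t surviving a cancellation of c-letters goes there. *)
Definition twist b (p : seq atom * bool) : seq atom * bool :=
  if p.1 is a :: w then ((b (+) a.1, a.2) :: w, p.2) else ([::], b (+) p.2).

Definition consr (a : atom) (p : seq atom * bool) : seq atom * bool :=
  if p.1 is b :: w then
    if cancels a.2 b then twist (a.1 (+) b.1) (w, p.2) else (a :: p.1, p.2)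
  else ([:: a], p.2).

Lemma walk_twist b p x y :
  walk p.1 p.2 (tw b x) y -> walk (twist b p).1 (twist b p).2 x y.
Proof. by case: p => [[|a w] e] /=; rewrite tw_tw addbC. Qed.

Lemma sorted_twist b p : sorted compat p.1 -> sorted compat (twist b p).1.
Proof. by case: p => [[|a [|a' w]] e]. Qed.

Lemma sorted_consr a p : sorted compat p.1 -> sorted compat (consr a p).1.
Proof.
case: p => [[|b w] e] //= red_w; rewrite /consr /=.
case: ifP => [_|]; last by rewrite /= /compat => ->.
by apply: sorted_twist; apply: path_sorted red_w.
Qed.

Lemma walk_consr a p x y :
  walk (a :: p.1) p.2 x y -> walk (consr a p).1 (consr a p).2 x y.
Proof.
case: p => [[|b w] e] //; rewrite /consr [_.1]/= [_.2]/=.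
case: ifP => // /andP[/eqP eb cancel_a] [z xz [z' zz' z'y]].
apply: walk_twist => /=; suff <- : z' = tw (a.1 (+) b.1) x by [].
rewrite eb in zz'; move/edge_linv: zz' => zz'.
rewrite addbC -tw_tw.
have /(edge_inj zz') // : edge a.2 (tw b.1 (tw a.1 x)) (tw b.1 z).
exact: edge_tw.
Qed.

Lemma conn_walk x y :
  conn x y -> exists w e, sorted compat w /\ walk w e x y.
Proof.
(* Atoms are prepended, so the path is built up from its end point [y]. *)
move=> /conn_sym; elim=> [|z _|l z z' _].
- by exists [::], false.
- move=> [w [e [red_w zx]]]; exists (twist true (w, e)).1, (twist true (w, e)).2.
  by split; [apply: sorted_twist | apply: walk_twist; rewrite /= valid_tK].
move=> [w [e [red_w zx]]] zz'.
pose p := consr (false, linv l) (w, e); exists p.1, p.2.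
split; first exact: sorted_consr.
by apply: walk_consr; exists z => //; apply/edge_linv.
Qed.

End Walks.

(** * One word acting on two components at once *)

Definition prod_t X Y (t : X -> X) (t' : Y -> Y) (p : X * Y) := (t p.1, t' p.2).
Definition prod_E X Y (E : gen -> X -> X -> Prop) (E' : gen -> Y -> Y -> Prop)
  g (p q : X * Y) := E g p.1 q.1 /\ E' g p.2 q.2.

Section Product.
Variables (X Y : Type) (t : X -> X) (t' : Y -> Y).
Variables (E : gen -> X -> X -> Prop) (E' : gen -> Y -> Y -> Prop).

Lemma tw_prod b p : tw (prod_t t t') b p = (tw t b p.1, tw t' b p.2).
Proof. by case: b p => [] []. Qed.

Lemma edge_prod l p q :
  edge (prod_E E E') l p q <-> edge E l p.1 q.1 /\ edge E' l p.2 q.2.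
Proof. by rewrite /edge; case: ifP. Qed.

Lemma walk_prod w e p q :
  walk (prod_t t t') (prod_E E E') w e p q <->
  walk t E w e p.1 q.1 /\ walk t' E' w e p.2 q.2.
Proof.
elim: w p => [|a w IHw] p /=.
  by rewrite tw_prod; case: q => q1 q2; split=> [[-> ->]|[/= -> ->]].
split=> [[z /edge_prod]|[[z1 pz1 z1q] [z2 pz2 z2q]]].
  by rewrite tw_prod => -[? ?] /IHw[? ?]; split; [exists z.1 | exists z.2].
exists (z1, z2); last exact/IHw.
by apply/edge_prod; rewrite tw_prod.
Qed.

Lemma valid_prod : valid t E -> valid t' E' -> valid (prod_t t t') (prod_E E E').
Proof.
move=> V V'; split.
- by case=> x y; rewrite /prod_t /= (valid_tK V) (valid_tK V').
- move=> g [x1 x2] [y1 y2] [z1 z2] [/= xy1 xy2] [/= xz1 xz2].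
  by rewrite (valid_fun V xy1 xz1) (valid_fun V' xy2 xz2).
- move=> g [x1 x2] [y1 y2] [z1 z2] [/= xy1 xy2] [/= xz1 xz2].
  by rewrite (valid_inj V xy1 xz1) (valid_inj V' xy2 xz2).
- move=> g p q g1 [pq1 pq2].
  by split; [apply: valid_t V _ _ _ _ pq1 | apply: valid_t V' _ _ _ _ pq2].
Qed.

End Product.

Definition sw X (p : X * X) := (p.2, p.1).

Section Pairs.
Variables (X : Type) (t : X -> X) (E : gen -> X -> X -> Prop).
Local Notation walk2 := (walk (prod_t t t) (prod_E E E)).
Local Notation conn2 := (conn (prod_t t t) (prod_E E E)).

(* For valid E this says that a word fixing two distinct points is trivial. *)
Definition sharp := forall w p, w != [::] -> cycle compat w ->
  p.1 <> p.2 -> ~ walk2 w false p p.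

Hypothesis V : valid t E.
Let V2 := valid_prod V V.

Lemma edge_sw l p q :
  edge (prod_E E E) l p q -> edge (prod_E E E) l (sw p) (sw q).
Proof. by move=> /edge_prod[? ?]; apply/edge_prod. Qed.

Lemma walk_sw w e p q : walk2 w e p q -> walk2 w e (sw p) (sw q).
Proof. by move=> /walk_prod[? ?]; apply/walk_prod. Qed.

Lemma conn_sw p q : conn2 p q -> conn2 (sw p) (sw q).
Proof.
elim=> [|p' _ pp'|l p' q' _ pp' /edge_sw]; first exact: conn_refl.
  exact: conn_t pp'.
exact: conn_edge.
Qed.

Lemma conn_neq p q : conn2 p q -> p.1 <> p.2 -> q.1 <> q.2.
Proof.
elim=> // [p' _ IHp /IHp|l p' q' _ IHp /edge_prod[pq1 pq2] /IHp] neq.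
  by move=> /= /(can_inj (valid_tK V)).
by move=> eq_q; apply: neq; apply: edge_inj V _ _ _ _ pq1 _; rewrite eq_q.
Qed.

Hypothesis (t_free : forall x, t x <> x) (sharpE : sharp).

(** Cyclic reduction with [s] the identity: [sharp] excludes the cyclically reduced case, and a
    conjugate of t fixes nothing because t is free. *)
Lemma sharp_reduced u e p :
  sorted compat u -> p.1 <> p.2 -> walk2 u e p p -> u = [::] /\ e = false.
Proof.
move=> red_u p_neq pp.
have [u0|[v [q [v0 cyc_v pq qq]]]|[q _ tq]] :=
  @cyclic_reduction _ _ _ V2 id _ _ _ (fun=> erefl) (fun=> erefl) (fun _ _ _ => id)
    red_u pp.
- split=> //; move: pp; rewrite u0 /= tw_prod; case: e => //.
  by case: (p) => p1 p2 [/= /t_free].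
- by case: (sharpE v0 cyc_v (conn_neq pq p_neq) qq).
- by case: q tq => ? ? [/t_free].
Qed.

(** Cyclic reduction with [s] the swap: the square of a cyclically reduced word swapping a pair
    would be a cyclically reduced word fixing it, so only a conjugate of t can swap. *)
Lemma sharp_swap u e p :
    sorted compat u -> p.1 <> p.2 -> walk2 u e p (sw p) ->
  exists z, conn2 p (z, t z).
Proof.
move=> red_u p_neq pp.
have [u0|[v [q [v0 cyc_v pq qq]]]|[q pq tq]] :=
  @cyclic_reduction _ _ _ V2 (@sw X) _ _ _ (fun=> erefl)
    (fun p => let: (x, y) := p in erefl) edge_sw red_u pp.
- move: pp p_neq; rewrite u0 /= tw_prod; case: p => x y; rewrite /sw /=.
  case: e => /= -[] // tx _ _; exists x; rewrite tx; exact: conn_refl.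
- have vv : cycle compat (v ++ v).
    case: v cyc_v {v0 qq} => //= a r; rewrite rcons_cat rcons_path cat_path /=.
    by rewrite !rcons_path => /andP[-> ->].
  have vv0 : v ++ v != [::] by case: (v) v0.
  case: (sharpE vv0 vv (conn_neq pq p_neq)).
  apply/walk_cat; exists (sw q) => //.
  by have := walk_sw qq; case: (q).
- by exists q.1; move: pq tq; case: q => /= x y pq [->].
Qed.

End Pairs.

(** * Extending a partial action by new edges *)

Lemma edge_mono X (E E' : gen -> X -> X -> Prop) l x y :
  (forall g x y, E g x y -> E' g x y) -> edge E l x y -> edge E' l x y.
Proof. by rewrite /edge => sEE'; case: l.2; apply: sEE'. Qed.

Lemma walk_mono X (t : X -> X) (E E' : gen -> X -> X -> Prop) w e x y :
  (forall g x y, E g x y -> E' g x y) -> walk t E w e x y -> walk t E' w e x y.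
Proof.
move=> sEE'; elim: w x => //= a w IHw x [z xz /IHw zy]; exists z => //.
exact: edge_mono xz.
Qed.

Lemma conn_mono X (t : X -> X) (E E' : gen -> X -> X -> Prop) x y :
  (forall g x y, E g x y -> E' g x y) -> conn t E x y -> conn t E' x y.
Proof.
move=> sEE'; elim=> [|z _|l z z' _ xz zz']; first exact: conn_refl.
  exact: conn_t.
exact: conn_edge xz (edge_mono sEE' zz').
Qed.

Section AddEdges.
Variables (X : Type) (t : X -> X) (E : gen -> X -> X -> Prop).
Variables (l0 : letter) (R : X -> X -> Prop).

Definition add_edges g x y :=
  E g x y \/ g = l0.1 /\ (if l0.2 then R x y else R y x).

Lemma edge_add l x y : edge add_edges l x y <->
  [\/ edge E l x y, l = l0 /\ R x y | l = linv l0 /\ R y x].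
Proof.
rewrite /edge /add_edges; case: l l0 => [g s] [g0 s0] /=.
by case: s; case: s0; (split=> [[?|[-> ?]]|[?|[[-> //] ?]|[[-> //] ?]]]);
  auto; do ?[by constructor 1|by constructor 2|by constructor 3].
Qed.

Hypothesis V : valid t E.
Hypothesis R_fun : forall x y y', R x y -> R x y' -> y = y'.
Hypothesis R_inj : forall x x' y, R x y -> R x' y -> x = x'.
Hypothesis R_t : l0.1.1 -> forall x y, R x y -> R (t x) (t y).
Hypothesis R_dom : forall x y z, R x y -> ~ edge E l0 x z.
Hypothesis R_cod : forall x y z, R x y -> ~ edge E l0 z y.

Lemma valid_add : valid t add_edges.
Proof.
have [tK Ef Ei Et] := V.
have R_dom' x y z : R x y -> ~ (if l0.2 then E l0.1 x z else E l0.1 z x).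
  exact: R_dom.
have R_cod' x y z : R x y -> ~ (if l0.2 then E l0.1 z y else E l0.1 y z).
  exact: R_cod.
split=> // [g x y y'|g x x' y|g x y g1]; rewrite /add_edges.
- move=> [xy|[-> xy]] [xy'|[]].
  + exact: Ef xy xy'.
  + move=> eg; subst g; case: (l0.2) R_dom' R_cod' => H1 H2 R'.
      by case: (H1 _ _ _ R' xy).
    by case: (H2 _ _ _ R' xy).
  + case: (l0.2) R_dom' R_cod' xy => H1 H2 R'.
      by case: (H1 _ _ _ R' xy').
    by case: (H2 _ _ _ R' xy').
  + by move=> _; case: (l0.2) xy => xy xy'; [apply: R_fun xy xy'|apply: R_inj xy xy'].
- move=> [xy|[-> xy]] [xy'|[]].
  + exact: Ei xy xy'.
  + move=> eg; subst g; case: (l0.2) R_dom' R_cod' => H1 H2 R'.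
      by case: (H2 _ _ _ R' xy).
    by case: (H1 _ _ _ R' xy).
  + case: (l0.2) R_dom' R_cod' xy => H1 H2 R'.
      by case: (H2 _ _ _ R' xy').
    by case: (H1 _ _ _ R' xy').
  + by move=> _; case: (l0.2) xy => xy xy'; [apply: R_inj xy xy'|apply: R_fun xy xy'].
move=> [xy|[eg xy]]; first by left; apply: Et.
right; split=> //; subst g.
by case: (l0.2) xy => xy; apply: R_t.
Qed.

End AddEdges.

(** * Finite approximations and extension at one point *)

Definition pt := (nat * bool)%type.
Definition flip (x : pt) : pt := (x.1, ~~ x.2).

Lemma flipK : involutive flip.
Proof. by case=> n b; rewrite /flip /= negbK. Qed.

Lemma flip_free x : flip x <> x.
Proof. by case: x => n [] []. Qed.

Lemma tw_flip b x : tw flip b x = (x.1, b (+) x.2).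
Proof. by case: b x => [] []. Qed.

Definition bounded N (E : gen -> pt -> pt -> Prop) :=
  forall g x y, E g x y -> [/\ (g.2 < N)%N, (x.1 < N)%N & (y.1 < N)%N].

Definition approx E := [/\ valid flip E, sharp flip E & exists N, bounded N E].

Section NewPoint.
Variables (E : gen -> pt -> pt -> Prop) (l0 : letter) (x0 : pt) (n : nat).
Hypothesis V : valid flip E.
Hypothesis E_old : forall g x y, E g x y -> (x.1 != n) && (y.1 != n).
Hypothesis x0_old : x0.1 != n.
Hypothesis x0_dom : forall z, ~ edge E l0 x0 z.

(** A new edge of a c-letter comes with its translate by t, to keep commuting with t; a d-letter
    gets the single edge [b = false]. *)
Let R (x y : pt) := exists2 b, l0.1.1 || ~~ b &
  x = tw flip b x0 /\ y = tw flip b (n, false).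

Definition add_point := add_edges E l0 R.

Lemma valid_add_point : valid flip add_point.
Proof.
apply: valid_add => //.
- move=> x y y' [b _ [-> ->]] [b' _]; rewrite !tw_flip /= => -[[]].
  by move=> /addIb <- ->.
- move=> x x' y [b _ [-> ->]] [b' _]; rewrite !tw_flip /= => -[->].
  by move=> [] /addIb <-.
- move=> l1 x y [b _ [-> ->]]; exists (~~ b); first by rewrite l1.
  by rewrite !tw_flip /flip /= !addNb.
- move=> x y z [b lb [-> _]] /(edge_tw V lb); rewrite (twK V).
  exact: x0_dom.
- move=> x y z [b lb [_ ->]]; rewrite tw_flip /edge.
  by case: ifP => _ /E_old /=; rewrite eqxx ?andbF.
Qed.

Lemma edge_old l x y : edge E l x y -> (x.1 != n) && (y.1 != n).
Proof. by rewrite /edge; case: ifP => _ /E_old // /andP[-> ->]. Qed.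

Lemma add_point_cod l x z : z.1 = n -> edge add_point l x z ->
  l = l0 /\ exists2 b, l0.1.1 || ~~ b & z = (n, b).
Proof.
move=> zn /edge_add[/edge_old/andP[_]|[-> [b lb [_ ->]]]|[_ [b _ [ez _]]]].
- by rewrite zn eqxx.
- by split=> //; exists b; rewrite // tw_flip addbF.
- by move: zn x0_old; rewrite ez tw_flip /= => ->; rewrite eqxx.
Qed.

(* The only edges at the new point are those of the letter l0, so a reduced word
   entering it cannot leave. *)
Lemma add_point_stuck u v x z :
  u ++ v != [::] -> cycle compat (u ++ v) ->
  walk flip add_point u false x z -> walk flip add_point v false z x -> z.1 != n.
Proof.
(* Rotating the cyclic word makes it start and end at [z]. *)
move=> uv0; rewrite -(rot_cycle (size u)) rot_size_cat => cyc xz zx.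
have : walk flip add_point (v ++ u) false z z by apply/walk_cat; exists x.
have : v ++ u != [::] by case: (u) (v) uv0 => [|? ?] [].
case: (v ++ u) cyc => // a r; rewrite /cycle rcons_path => /andP[_ compat_a] _ zz.
apply/eqP=> zn.
have [y zy _] := zz.
have edge_z : edge (add_point) (linv a.2) y (tw flip a.1 z) by apply/edge_linv.
have [la [b lb zb]] : linv a.2 = l0 /\
    exists2 b, l0.1.1 || ~~ b & tw flip a.1 z = (n, b).
  by apply: add_point_cod edge_z; rewrite tw_flip.
move: zz; rewrite lastI -cats1 => /walk_cat[y' _ [z' yz' ez']].
rewrite /= in ez'; subst z'.
have [lr [b' lb' zb']] := add_point_cod zn yz'.
(* The word enters the new orbit by [l0] and leaves by its inverse. For a d-letter both edges meet
   the orbit in [(n, false)], so no t lies between them; either way the two letters cancel. *)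
move: compat_a; rewrite /compat /cancels lr -la linvK eqxx /= => /negP[].
move: lb lb' zb; rewrite zb' tw_flip -la /= => + + [eb].
by rewrite -eb; case: (a.2.1.1) => //=; case: (a.1) (b') => [] [].
Qed.

Lemma walk_add_point w e x y :
  (forall u v z, w = u ++ v -> walk flip add_point u false x z ->
     walk flip add_point v e z y -> z.1 != n) ->
  walk flip add_point w e x y -> walk flip E w e x y.
Proof.
elim: w x => //= a w IHw x w_old /[dup] xy [z xz zy]; exists z; last first.
  apply: IHw => // u v z' wuv zz' z'y; apply: (w_old (a :: u) v) => //.
    by rewrite wuv.
  by exists z.
have x_old := w_old [::] (a :: w) x erefl erefl xy.
have z_old : z.1 != n by apply: (w_old [:: a] w) => //; exists z.
case/edge_add: xz => // -[_ [b _ []]].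
  by move=> _ ez; move: z_old; rewrite ez tw_flip eqxx.
move=> _ ex; move: x_old; have := congr1 fst ex.
by rewrite !tw_flip /= => ->; rewrite eqxx.
Qed.

Lemma sharp_add_point : sharp flip E -> sharp flip add_point.
Proof.
move=> sharpE w p w0 cyc_w p_neq /walk_prod[w1 w2].
apply: (sharpE w p w0 cyc_w p_neq); apply/walk_prod.
by split; apply: walk_add_point => // u v z w_uv xz zx;
  apply: add_point_stuck xz zx; rewrite -w_uv.
Qed.

End NewPoint.

Lemma approx_edge E l x : approx E ->
  exists E', [/\ approx E', forall g x y, E g x y -> E' g x y
               & exists z, edge E' l x z].
Proof.
move=> CE; have [V sharpE [N bN]] := CE.
have [[z xz]|x_dom] := pselect (exists z, edge E l x z).
  by exists E; split=> //; exists z.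
(* Neither [l] nor [x] need occur in [E], so [n] must also exceed the index of [l] and the orbit of
   [x]. *)
pose n := maxn N (maxn l.1.2 x.1).+1.
have E_old g u v : E g u v -> (u.1 != n) && (v.1 != n).
  by move=> /bN[_ uN vN]; rewrite !ltn_eqF //; apply: leq_trans (leq_maxl _ _).
have x_old : x.1 != n.
  by rewrite ltn_eqF // (leq_trans _ (leq_maxr _ _)) // ltnS leq_maxr.
have x_dom' z : ~ edge E l x z by move=> xz; apply: x_dom; exists z.
exists (add_point E l x n); split; last 2 first.
- by move=> g u v Euv; left.
- exists (n, false); apply/edge_add; constructor 2; split=> //.
  by exists false; rewrite // orbT.
split; first exact: valid_add_point.
  exact: sharp_add_point.
have Nn : (N <= n)%N := leq_maxl _ _.
have xn : (x.1 < n)%N.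
  by rewrite (leq_trans _ (leq_maxr _ _)) // ltnS leq_maxr.
have ln : (l.1.2 < n)%N.
  by rewrite (leq_trans _ (leq_maxr _ _)) // ltnS leq_maxl.
exists n.+1 => g u v [/bN[gN uN vN]|[-> ]].
  by split; apply: ltnW; apply: leq_ltn_trans _ (ltnSn _); apply: leq_trans Nn.
case: (l.2) => -[b _ [-> ->]]; rewrite !tw_flip /= !ltnS.
  by split=> //; apply: ltnW.
by split=> //; apply: ltnW.
Qed.

Lemma walk_rot X (t : X -> X) E i w x : walk t E w false x x ->
  exists2 y, conn t E x y & walk t E (rot i w) false y y.
Proof.
rewrite -{1}(cat_take_drop i w) => /walk_cat[y xy yx]; exists y.
  exact: walk_conn xy.
by apply/walk_cat; exists x.
Qed.

Section FreshGenerator.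
Variables (X : Type) (t : X -> X) (E : gen -> X -> X -> Prop).
Variables (g0 : gen) (q0 : X * X) (o : X).
Local Notation conn2 E := (conn (prod_t t t) (prod_E E E)).
Local Notation walk2 E := (walk (prod_t t t) (prod_E E E)).
Local Notation edge2 E := (edge (prod_E E E)).
Let p0 := (o, t o).

Hypothesis V : valid t E.
Hypothesis t_free : forall x, t x <> x.
Hypothesis sharpE : sharp t E.
Hypothesis g0_fresh : forall x y, ~ E g0 x y.
Hypothesis q0_neq : q0.1 <> q0.2.
Hypothesis q0_p0 : ~ conn2 E q0 p0.
(** A c-generator commutes with t, hence can reach the base pair only from some (z, t z). For a
    d-generator, a word swapping [q0] would yield a conjugate swapping the base pair as t does, and
    its product with t would fix that pair. *)
Hypothesis q0_swap : if g0.1 then q0.2 = t q0.1 else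
  forall u e, sorted compat u -> ~ walk2 E u e q0 (sw q0).

Let R x y := (x = q0.1 /\ y = p0.1) \/ (x = q0.2 /\ y = p0.2).

Definition add_gen := add_edges E (g0, true) R.

Lemma valid_add_gen : valid t add_gen.
Proof.
apply: valid_add => //.
- move=> x y y' [[-> ->]|[-> ->]] [[? ->]|[? ->]] //.
  by case: q0_neq.
- move=> x x' y [[-> ->]|[-> ->]] [[->]|[->]] //=.
    by move=> /esym/t_free.
  by move=> /t_free.
- move=> /= g01; move: q0_swap; rewrite g01 => q02 x y.
  rewrite /R q02 /= => -[[-> ->]|[-> ->]]; [by right|left].
  by rewrite !(valid_tK V).
- by move=> x y z _; apply: g0_fresh.
- by move=> x y z _; apply: g0_fresh.
Qed.

Let V2 := valid_prod V V.
Let V2' := valid_prod valid_add_gen valid_add_gen.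

(** The letter [g0] has just two edges, and distinct points must use both, so on pairs it only joins
    [q0] to [p0], up to a simultaneous swap. *)
Lemma edge_add_gen l p q : p.1 <> p.2 -> q.1 <> q.2 -> edge2 add_gen l p q ->
  if l.1 == g0 then
    let (p', q') := if l.2 then (q0, p0) else (p0, q0) in
    (p = p' /\ q = q') \/ (p = sw p' /\ q = sw q')
  else edge2 E l p q.
Proof.
have noE l' x y : l'.1 = g0 -> ~ edge E l' x y.
  by rewrite /edge => ->; case: ifP => _; apply: g0_fresh.
case: p q => [x x'] [y y'] /= neq_x neq_y /edge_prod[/= /edge_add xy /edge_add xy'].
case: eqP => [lg|lg]; last first.
  apply/edge_prod; split=> /=.
    by case: xy => // -[el _]; move: lg; rewrite el.
  by case: xy' => // -[el _]; move: lg; rewrite el.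
case: xy => [/noE//|[el xy]|[el xy]].
all: case: xy' => [/noE//|[el' xy']|[el' xy']]; try by move: el'; rewrite el.
all: rewrite el /= /sw; case: xy => [[? ?]|[? ?]]; case: xy' => [[? ?]|[? ?]].
all: subst; rewrite /= in neq_x neq_y *.
all: by [case: neq_x|case: neq_y|left; split=> //; case: (q0)|right].
Qed.

Lemma walk_fresh w e p q : p.1 <> p.2 ->
  ~~ has (fun a : atom => a.2.1 == g0) w -> walk2 add_gen w e p q -> walk2 E w e p q.
Proof.
elim: w p => //= a w IHw p p_neq; rewrite negb_or => /andP[a_g0 w_g0] [z pz zq].
have pz_conn : conn2 add_gen p z by apply: conn_edge pz; apply: conn_tw.
have z_neq := conn_neq valid_add_gen pz_conn p_neq.
have tp_neq := conn_neq valid_add_gen (conn_tw _ _ a.1 p) p_neq.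
exists z; last exact: IHw.
by move: (edge_add_gen tp_neq z_neq pz); rewrite (negbTE a_g0).
Qed.

Let is_pair (p q : X * X) := q = p \/ q = sw p.

(** The involution t swaps [p0], so both orders of [p0] lie in one orbit; a swap of [q0] is
    transferred to the other side. *)
Lemma add_gen_unrelated p q : is_pair q0 p -> is_pair p0 q -> ~ conn2 E p q.
Proof.
have unrel q' : is_pair p0 q' -> ~ conn2 E q0 q'.
  case=> -> // qp; apply: q0_p0.
  suff -> : p0 = prod_t t t (sw p0) by apply: conn_t.
  by rewrite /prod_t /= (valid_tK V).
case=> -> pq; first exact: unrel.
move=> /conn_sw qp; apply: (unrel (sw q)); last first.
  by move: qp; case: (q0).
by case: pq => ->; [right|left].
Qed.

(** Between [a0] and the next cyclic occurrence [a1] of [g0] the word walks in [E]. Equal signs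
    would join [q0] to [p0]. Negative followed by positive would lead from [q0] back to [q0] up to a
    swap, which sharpness and [q0_swap] reduce to a cancellation. Only positive followed by negative
    survives. *)
Lemma sharp_add_gen_next a0 r p : a0.2.1 = g0 -> p.1 <> p.2 ->
  cycle compat (a0 :: r) -> walk2 add_gen (a0 :: r) false p p ->
  a0.2.2 /\ has (fun a : atom => a.2 == (g0, false)) (a0 :: r).
Proof.
move=> a0g p_neq cyc_w [p1 pp1 p1p].
have neq_conn q q' := conn_neq (p := q) (q := q') valid_add_gen.
have p1_neq : p1.1 <> p1.2.
  by apply: neq_conn p_neq; apply: conn_edge pp1; apply: conn_tw.
have p1p1 : walk2 add_gen (rcons r a0) false p1 p1.
  by rewrite -cats1; apply/walk_cat; exists p => //; exists p1.
(* Searching the rotated word allows [a0] itself to be the next occurrence. *)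
have has_r : has (fun a : atom => a.2.1 == g0) (rcons r a0).
  by rewrite has_rcons a0g eqxx.
have mem_r a : a \in rcons r a0 -> a \in a0 :: r by rewrite mem_rcons.
move: cyc_w p1p1 mem_r; rewrite /cycle.
case: (split_find has_r) => a1 u v /eqP a1g u_g0 {has_r}.
rewrite cat_path rcons_path => /andP[/andP[red_u compat_a] _] /walk_cat[p4].
rewrite -cats1 => /walk_cat[p2 p12 [p4' p24 _]] _ mem_r {p4}.
have p2_neq : p2.1 <> p2.2 by apply: neq_conn p1_neq; apply: walk_conn p12.
have tp_neq : (tw (prod_t t t) a1.1 p2).1 <> (tw (prod_t t t) a1.1 p2).2.
  by apply: neq_conn p2_neq; apply: conn_tw.
have p4_neq : p4'.1 <> p4'.2.
  by apply: neq_conn tp_neq; apply: conn_edge p24; apply: conn_refl.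
have tp0_neq : (tw (prod_t t t) a0.1 p).1 <> (tw (prod_t t t) a0.1 p).2.
  by apply: neq_conn p_neq; apply: conn_tw.
set p3 := tw (prod_t t t) a1.1 p2 in tp_neq p24.
have p13 : walk2 E u a1.1 p1 p3.
  apply: walk_fresh p1_neq u_g0 _.
  by have := walk_tw V2' a1.1 p12; rewrite addbF.
have {pp1}p1E : is_pair (if a0.2.2 then p0 else q0) p1.
  have := edge_add_gen tp0_neq p1_neq pp1; rewrite a0g eqxx.
  by case: ifP => _ [[_ ->]|[_ ->]]; [left|right|left|right].
have {p24}p3E : is_pair (if a1.2.2 then q0 else p0) p3.
  have := edge_add_gen tp_neq p4_neq p24; rewrite a1g eqxx.
  by case: ifP => _ [[-> _]|[-> _]]; [left|right|left|right].
have c13 := walk_conn p13.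
have {}red_u := path_sorted red_u.
case a0s: a0.2.2 p1E p3E => p1E; case a1s: a1.2.2 => p3E.
- by case: (add_gen_unrelated p3E p1E); apply: (conn_sym V2).
- split=> //; apply/hasP; exists a1; last by rewrite -a1g -a1s -surjective_pairing.
  by apply: mem_r; rewrite !mem_cat mem_head orbT.
- suff : cancels (last a0 u).2 a1 by rewrite -[cancels _ _]negbK (negbTE compat_a).
  have el : a1.2 = linv a0.2.
    by rewrite /linv a0s a0g /= -a1g -a1s -surjective_pairing.
  suff [-> a1e] : u = [::] /\ (g0.1 || ~~ a1.1).
    by rewrite /cancels /= el eqxx a0g.
  have [e13|e13] : p3 = p1 \/ p3 = sw p1.
    by case: p1E p3E => -> [] ->; case: (q0); [left|right|right|left].
    rewrite e13 in p13.
    by have [-> ->] := sharp_reduced V t_free sharpE red_u p1_neq p13; rewrite orbT.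
  (* For a c-generator the swap of [q0] is t, so multiplying by t turns the swapping word into one
     fixing the pair; for a d-generator swaps are excluded. *)
  rewrite e13 in p13; move: q0_swap; case: ifP => [_ q02|_ no_swap].
    have p1t : sw p1 = prod_t t t p1.
      by case: p1E => ->; rewrite /prod_t /sw q02 /= (valid_tK V).
    have := walk_tw V2 true p13; rewrite p1t [tw _ true _]/= (valid_tK V2) => p11.
    by have [-> _] := sharp_reduced V t_free sharpE red_u p1_neq p11.
  case: (no_swap u a1.1 red_u); case: p1E p13 => -> //.
  by move=> /walk_sw; case: (q0).
- by case: (add_gen_unrelated p1E p3E).
Qed.

(* Along a cyclic word the signs of the fresh letter would have to be positive
   everywhere, yet a positive occurrence is followed by a negative one. *)
Lemma sharp_add_gen : sharp t add_gen.
Proof.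
move=> w p w0 cyc_w p_neq pp.
have [|w_g0] := boolP (has (fun a : atom => a.2.1 == g0) w); last first.
  exact: sharpE w0 cyc_w p_neq (walk_fresh p_neq w_g0 pp).
have rot_neg a : a \in w -> a.2.1 = g0 ->
    a.2.2 /\ has (fun b : atom => b.2 == (g0, false)) w.
  move=> /rot_to[i r rw] ag; have [q pq] := walk_rot i pp.
  rewrite -(has_rot i) rw => qq; apply: sharp_add_gen_next ag _ _ qq.
    exact: conn_neq valid_add_gen _ _ pq p_neq.
  by rewrite -rw rot_cycle.
move=> /hasP[a aw /eqP ag]; have [_ /hasP[b bw /eqP bg]] := rot_neg a aw ag.
by have := rot_neg b bw; rewrite bg => -[].
Qed.

End FreshGenerator.

(** * The limit of the approximations *)

Definition origin : pt := (0%N, false).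
Local Notation conn2 E := (conn (prod_t flip flip) (prod_E E E)).

Lemma prod_E_mono X (E E' : gen -> X -> X -> Prop) :
  (forall g x y, E g x y -> E' g x y) ->
  forall g p q, prod_E E E g p q -> prod_E E' E' g p q.
Proof. by move=> sEE' g p q [? ?]; split; apply: sEE'. Qed.

Lemma approx_add_gen k E (q : pt * pt) : approx E -> q.1 <> q.2 ->
    ~ conn2 E q (origin, flip origin) ->
    (if k then q.2 = flip q.1 else forall u e, sorted compat u ->
       ~ walk (prod_t flip flip) (prod_E E E) u e q (sw q)) ->
  exists E', [/\ approx E', forall g x y, E g x y -> E' g x y
               & conn2 E' q (origin, flip origin)].
Proof.
move=> [V sharpE [N bN]] q_neq q_o q_k.
have fresh x y : ~ E (k, N) x y by move=> /bN[/=]; rewrite ltnn.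
exists (add_gen flip E (k, N) q origin); split; last 2 first.
- by move=> g x y; left.
- apply: (conn_edge (l := ((k, N), true))) (conn_refl _ _ _) _.
  by apply/edge_prod; split; right; split=> //=; [left | right].
split.
- exact: (valid_add_gen origin V flip_free fresh q_neq q_k).
- exact: (sharp_add_gen V flip_free sharpE fresh q_neq q_o q_k).
exists (maxn N (maxn q.1.1 q.2.1)).+1 => g x y.
case=> [/bN[gN xN yN]|[-> /= R]].
  by split; apply: leq_trans (leqW (leq_maxl _ _)).
rewrite !ltnS leq_maxl; case: R => -[-> ->]; split=> //.
  exact: leq_trans (leq_maxl _ _) (leq_maxr _ _).
exact: leq_trans (leq_maxr _ _) (leq_maxr _ _).
Qed.

(** If the orbit of [q] contains some (z, t z), a new c-generator sends that pair to the base pair;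
    otherwise [sharp_swap] shows that no word swaps [q], and a new d-generator applies. *)
Lemma approx_conn E (q : pt * pt) : approx E -> q.1 <> q.2 ->
  exists E', [/\ approx E', forall g x y, E g x y -> E' g x y
               & conn2 E' q (origin, flip origin)].
Proof.
move=> CE q_neq; have [V sharpE _] := CE.
have [qo|qo] := pselect (conn2 E q (origin, flip origin)); first by exists E.
have [[z qz]|no_z] := pselect (exists z, conn2 E q (z, flip z)).
  have [|||E' [CE' sEE' zo]] := @approx_add_gen true E (z, flip z) CE => //.
    by move=> /= /esym/flip_free.
  - by move=> zo; apply/qo/(conn_trans qz).
  exists E'; split=> //.
  exact: conn_trans (conn_mono (prod_E_mono sEE') qz) zo.
apply: (@approx_add_gen false) => // u e red_u uq; apply: no_z.
exact: (sharp_swap V sharpE red_u q_neq uq).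
Qed.

Lemma approx_empty : approx (fun _ _ _ => False).
Proof.
split=> //; last by exists 0%N.
  by split=> //; apply: flipK.
case=> // a w p _ _ _ [z /edge_prod[+ _] _].
by rewrite /edge; case: ifP.
Qed.

(** The requirements, one for each letter at a point and one for each pair of points, are enumerated
    by [pickle], and step [n] meets the one coded by [n]. A walk in the union is finite, hence lies
    in one stage, so sharpness passes to the limit. *)
Lemma exists_sharp_structure : exists E,
  [/\ valid flip E, sharp flip E, forall l x, exists z, edge E l x z
    & forall q : pt * pt, q.1 <> q.2 -> conn2 E q (origin, flip origin)].
Proof.
pose meets E (r : letter * pt + pt * pt) := match r with
  | inl lx => exists z, edge E lx.1 lx.2 z
  | inr q => q.1 <> q.2 -> conn2 E q (origin, flip origin) end.
have /choice[next nextP] : forall s : {E | approx E} * nat, exists E' : {E | approx E},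
    (forall g x y, sval s.1 g x y -> sval E' g x y) /\
    (forall r, unpickle s.2 = Some r -> meets (sval E') r).
  move=> [[E CE] n] /=.
  case: (unpickle n) => [r|]; last by exists (exist _ E CE); split.
  suff [E' [CE' sEE' rE']] : exists E',
      [/\ approx E', forall g x y, E g x y -> E' g x y & meets E' r].
    by exists (exist _ E' CE'); split=> // _ [<-].
  case: r => [[l x]|q]; first exact: approx_edge.
  have [qE|q_neq] := pselect (q.1 = q.2); first by exists E; split.
  by have [E' [? ? ?]] := approx_conn CE q_neq; exists E'; split.
pose s := fix s n := if n is m.+1 then next (s m, m)
                     else exist _ _ approx_empty.
pose U g x y := exists n, sval (s n) g x y.
have s_mono m n g x y : (m <= n)%N -> sval (s m) g x y -> sval (s n) g x y.
  elim: n => [|n IHn]; first by rewrite leqn0 => /eqP ->.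
  rewrite leq_eqVlt => /predU1P[-> //|mn] /(IHn mn).
  by have [+ _] := nextP (s n, n); apply.
have s_cond n : approx (sval (s n)) := proj2_sig (s n).
have sU n g x y : sval (s n) g x y -> U g x y by exists n.
have U_edge l x y : edge U l x y -> exists n, edge (sval (s n)) l x y.
  by rewrite /edge; case: l.2.
have edge_s m n l x y : (m <= n)%N -> edge (sval (s m)) l x y -> edge (sval (s n)) l x y.
  by move=> mn; apply: edge_mono => ? ? ?; apply: s_mono.
have U_walk w e x y : walk flip U w e x y -> exists n, walk flip (sval (s n)) w e x y.
  elim: w x => [|a w IHw] x /=; first by exists 0%N.
  move=> [z /U_edge[m xz] /IHw[n zy]]; exists (maxn m n), z.
    exact: edge_s (leq_maxl _ _) xz.
  by apply: walk_mono zy => ? ? ?; apply: s_mono (leq_maxr _ _).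
have meetsU r : meets U r.
  have [_ /(_ r (pickleK r))] := nextP (s (pickle r), pickle r).
  move: (sU (pickle r).+1) => /=; case: r => [[l x] sUr [z xz]|q sUr qo /qo].
    by exists z; apply: edge_mono sUr xz.
  exact: conn_mono (prod_E_mono sUr).
exists U; split.
- split; first exact: flipK.
  + move=> g x y y' [m xy] [n xy'].
    have [V _ _] := s_cond (maxn m n).
    exact: valid_fun V _ _ _ _ (s_mono _ _ _ _ _ (leq_maxl _ _) xy)
      (s_mono _ _ _ _ _ (leq_maxr _ _) xy').
  + move=> g x x' y [m xy] [n xy'].
    have [V _ _] := s_cond (maxn m n).
    exact: valid_inj V _ _ _ _ (s_mono _ _ _ _ _ (leq_maxl _ _) xy)
      (s_mono _ _ _ _ _ (leq_maxr _ _) xy').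
  + move=> g x y g1 [n xy]; exists n.
    by have [V _ _] := s_cond n; apply: valid_t V _ _ _ g1 xy.
- move=> w p w0 cyc_w p_neq /walk_prod[/U_walk[m w1] /U_walk[n w2]].
  have [_ sharp_s _] := s_cond (maxn m n).
  apply: sharp_s w0 cyc_w p_neq _; apply/walk_prod; split.
    by apply: walk_mono w1 => ? ? ?; apply: s_mono (leq_maxl _ _).
  by apply: walk_mono w2 => ? ? ?; apply: s_mono (leq_maxr _ _).
- by move=> l x; apply: (meetsU (inl (l, x))).
- by move=> q; apply: (meetsU (inr q)).
Qed.

(** * Ping-pong in SL_3(Z) *)

Local Open Scope ring_scope.

Definition sgn100 (b : bool) : int := if b then 100 else - 100.


(* coneC b is the set entered under c_j^(+-1), and coneD b the set entered under
   d_j^(+-1), with b the sign, in the coordinates of [frame j] below; the last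
   condition says that the same letter applies again without cancellation. *)
Definition nearC (x y s : int) :=
  [&& y != 0, 10 * `|x| <= `|y| & 10 * `|s| <= `|y| ].

Definition coneC (b : bool) (x y s : int) :=
  nearC x y s && (`|y + sgn100 b * s| == `|y| + 100 * `|s| ).

(** The linear form of the transvections d_j in their frame; it vanishes on their direction (1, 2,
    1). *)
Definition formD (x y s : int) : int := - x + y - s.

(** Like [nearC], this involves absolute values only, so it survives t, which negates [y] and
    [s]. *)
Definition nearD (x y s : int) :=
  [&& x != 0, `|x| <= `|y|, `|x| <= 2 * `|s|, `|y| <= 3 * `|x| & `|s| <= 2 * `|x| ].

Definition coneD (b : bool) (x y s : int) :=
  [&& x != 0, 10 * `|y - 2 * x| <= `|x|, 10 * `|s - x| <= `|x|
    & `|x + sgn100 b * formD x y s| == `|x| + 100 * `|formD x y s| ].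

Lemma coneD_nearD b x y s : coneD b x y s -> nearD x y s.
Proof. by rewrite /coneD /nearD; case/and4P=> h1 h2 h3 _; lia. Qed.

(** The constants fit because 100 - 9 is at least 10 * 9: the new second coordinate is dominated by
    the added term and has its sign. *)
Lemma coneC_intro b x y s : s != 0 -> `|x| <= 9 * `|s| -> `|y| <= 9 * `|s| ->
  coneC b x (y + sgn100 b * s) s.
Proof. by rewrite /coneC /nearC /sgn100; case: b; lia. Qed.

Lemma coneD_intro b x y s : let f := formD x y s in f != 0 ->
  `|x| <= 9 * `|f| -> `|y - 2 * x| <= 9 * `|f| -> `|s - x| <= 9 * `|f| ->
  coneD b (x + sgn100 b * f) (y + 2 * (sgn100 b * f)) (s + sgn100 b * f).
Proof.
move=> f f0 xf yf sf; rewrite /coneD.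
set x' := x + _; set y' := y + _; set s' := s + _.
have -> : formD x' y' s' = f by rewrite /f /formD /x' /y' /s'; lia.
by rewrite /x' /y' /s' /sgn100; case: b {x' y' s'}; lia.
Qed.

(** Here and below, [s + 100 * P] is the third coordinate after a change of frame, with [P] the
    difference of indices times [y]; [P = 0] stands for equal indices. *)
Lemma coneC_C b x y s P : nearC x y s -> `|y| <= `|P| ->
  coneC b x (y + sgn100 b * (s + 100 * P)) (s + 100 * P).
Proof. by case/and3P=> *; apply: coneC_intro; lia. Qed.

Lemma coneC_D b x y s P : nearC x y s -> P = 0 \/ `|y| <= `|P| ->
  let f := sgn100 b * formD x y (s + 100 * P) in
  coneD b (x + f) (y + 2 * f) (s + 100 * P + f).
Proof. by case/and3P=> *; apply: coneD_intro; rewrite /formD; lia. Qed.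

Lemma coneD_C b x y s P : nearD x y s -> P = 0 \/ `|y| <= `|P| ->
  coneC b x (y + sgn100 b * (s + 100 * P)) (s + 100 * P).
Proof. by case/and5P=> *; apply: coneC_intro; lia. Qed.

Lemma coneD_D b x y s P : nearD x y s -> `|y| <= `|P| ->
  let f := sgn100 b * formD x y (s + 100 * P) in
  coneD b (x + f) (y + 2 * f) (s + 100 * P + f).
Proof. by case/and5P=> *; apply: coneD_intro; rewrite /formD; lia. Qed.

(** Near the direction (1, 2, 1) the form is close to -2x after t, far from 0, so d_j expands with
    either sign. *)
Lemma coneD_opp b b' x y s : coneD b x y s ->
  let f := sgn100 b' * formD x (- y) (- s) in
  coneD b' (x + f) (- y + 2 * f) (- s + f).
Proof. by case/and4P=> *; apply: coneD_intro; rewrite /formD; lia. Qed.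

Lemma coneC_id b x y s : coneC b x y s -> coneC b x (y + sgn100 b * s) s.
Proof. by rewrite /coneC /nearC /sgn100; case: b; lia. Qed.

Lemma coneD_id b x y s : coneD b x y s ->
  let f := sgn100 b * formD x y s in
  coneD b (x + f) (y + 2 * f) (s + f).
Proof. by rewrite /coneD /formD /sgn100; case: b; lia. Qed.
(* Both sides are the determinant of the block matrix (1, -f; p, 1). *)
Lemma det_add_rank1 (R : comNzRingType) n (p : 'cV[R]_n) (f : 'rV[R]_n) :
  \det (1%:M + p *m f) = 1 + (f *m p) 0 0.
Proof.
have E1 : block_mx 1%:M (- f) p 1%:M =
    block_mx 1%:M 0 p 1%:M *m block_mx 1%:M (- f) 0 (1%:M + p *m f).
  by rewrite mulmx_block !mul0mx !mul1mx !mulmx1 !addr0 mulmxN addrC addrK.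
have E2 : block_mx 1%:M (- f) p 1%:M =
    block_mx (1%:M + f *m p) (- f) 0 1%:M *m block_mx 1%:M 0 p 1%:M.
  by rewrite mulmx_block !mul0mx !mul1mx !mulmx1 mulmx0 !add0r mulNmx addrK.
have : \det (1%:M + p *m f) = \det (1%:M + f *m p).
  have := congr1 determinant E1; rewrite E2 !det_mulmx !det_ublock !det_lblock.
  by rewrite !det1 !mul1r !mulr1.
by move=> ->; rewrite det_mx11 !mxE eqxx.
Qed.

(** * The generators as transvection matrices *)

Definition vec3 (x y z : int) : 'cV[int]_3 := \col_i [:: x; y; z]`_i.
Definition row3 (x y z : int) : 'rV[int]_3 := \row_i [:: x; y; z]`_i.

Lemma row3_vec3 a b c x y z :
  row3 a b c *m vec3 x y z = (a * x + b * y + c * z)%:M.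
Proof.
apply/matrixP => i j; rewrite !mxE !big_ord_recl big_ord0 !mxE /= !ord1 addr0.
by rewrite mulr1n addrA.
Qed.

Lemma vec3D x y z x' y' z' : vec3 x y z + vec3 x' y' z' = vec3 (x + x') (y + y') (z + z').
Proof. by apply/colP => -[[|[|[|]]] //= ?]; rewrite !mxE. Qed.

Lemma vec3Z a x y z : a *: vec3 x y z = vec3 (a * x) (a * y) (a * z).
Proof. by apply/colP => -[[|[|[|]]] //= ?]; rewrite !mxE. Qed.

Lemma vec3_inj x y z x' y' z' :
  vec3 x y z = vec3 x' y' z' -> [/\ x = x', y = y' & z = z'].
Proof.
by move=> /colP E; split; [have := E 0|have := E 1|have := E (Ordinal (isT : 2 < 3)%N)];
 rewrite !mxE.
Qed.

Lemma rank1_vec3 a b c a' b' c' x y z : let f := a' * x + b' * y + c' * z in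
  (1%:M + vec3 a b c *m row3 a' b' c') *m vec3 x y z =
  vec3 (x + f * a) (y + f * b) (z + f * c).
Proof.
by rewrite mulmxDl mul1mx -mulmxA row3_vec3 mul_mx_scalar vec3Z vec3D.
Qed.

(** Column [p] and row [f] of a transvection 1 + p f with f p = 0; negating [f] gives the
    inverse. *)
Definition gen_col (g : gen) : 'cV[int]_3 :=
  if g.1 then vec3 0 1 (100 * g.2%:Z) else vec3 1 2 (1 + 200 * g.2%:Z).

Definition gen_row (g : gen) (c : int) : 'rV[int]_3 :=
  if g.1 then row3 0 (- c * (100 * g.2%:Z)) c
  else row3 (- c) (c * (1 + 100 * g.2%:Z)) (- c).

Definition gen_mx (l : letter) : 'M[int]_3 :=
  1%:M + gen_col l.1 *m gen_row l.1 (sgn100 l.2).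

Lemma gen_row_col g c : gen_row g c *m gen_col g = 0.
Proof.
rewrite /gen_row /gen_col; case: ifP => _; rewrite row3_vec3;
  set a := (X in X%:M); (have -> : a = 0 by rewrite /a; ring); exact: raddf0.
Qed.

Lemma det_gen_mx l : \det (gen_mx l) == 1.
Proof. by rewrite det_add_rank1 gen_row_col mxE addr0. Qed.

Definition t_mx : 'M[int]_3 := diag_mx (row3 1 (- 1) (- 1)).

Lemma det_t_mx : \det t_mx == 1.
Proof. by rewrite det_diag !big_ord_recl big_ord0 !mxE. Qed.

Definition gen_sl l : 'SL_3[int] := SpecialLinear (det_gen_mx l).
Definition t_sl : 'SL_3[int] := SpecialLinear det_t_mx.

Lemma gen_mx_linv l : gen_mx (linv l) *m gen_mx l = 1%:M.
Proof.
rewrite /gen_mx /=; set p := gen_col _.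
have -> : gen_row l.1 (sgn100 (~~ l.2)) = - gen_row l.1 (sgn100 l.2).
  have -> : sgn100 (~~ l.2) = - sgn100 l.2 by rewrite /sgn100; case: l.2.
  apply/rowP => i; rewrite !mxE /gen_row; case: ifP => _; rewrite !mxE;
  by case: i => [[|[|[|]]] //= ?]; ring.
set f := gen_row _ _.
have ff : p *m f *m (p *m f) = 0.
  by rewrite mulmxA -(mulmxA p) gen_row_col mulmx0 mul0mx.
by rewrite mulmxN mulmxDl mul1mx mulNmx mulmxDr mulmx1 ff addr0 addrK.
Qed.

(* Coordinates in which the generators of index j have the same matrices as
   those of index 0. *)
Definition frame (j x y s : int) := vec3 x y (s + 100 * j * y).

Lemma frame_shift i j x y s : frame i x y s = frame j x y (s + 100 * ((i - j) * y)).
Proof. by rewrite /frame; congr vec3; ring. Qed.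

Lemma t_mx_frame j x y s : t_mx *m frame j x y s = frame j x (- y) (- s).
Proof.
rewrite mul_diag_mx /frame; apply/colP => i; rewrite !mxE.
by case: i => [[|[|[|]]] //= ?]; ring.
Qed.

Lemma gen_mxC_frame (n : nat) b x y s :
  gen_mx (true, n, b) *m frame n x y s = frame n x (y + sgn100 b * s) s.
Proof.
rewrite /gen_mx /gen_col /gen_row /= /frame rank1_vec3.
by congr vec3; ring.
Qed.

Lemma gen_mxD_frame (n : nat) b x y s : let f := sgn100 b * formD x y s in
  gen_mx (false, n, b) *m frame n x y s = frame n (x + f) (y + 2 * f) (s + f).
Proof.
rewrite /gen_mx /gen_col /gen_row /= /frame rank1_vec3 /formD.
by congr vec3; ring.
Qed.

(** The index is an integer, not a natural number, so that a vector can be placed in a cone of index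
    -1, which no generator has. *)
Definition cone_at (k : bool) (j : int) (b : bool) (v : 'cV[int]_3) :=
  exists x y s, v = frame j x y s /\ (if k then coneC b x y s else coneD b x y s).

Definition t_pow (e : bool) : 'M[int]_3 := if e then t_mx else 1%:M.

Lemma t_pow_frame e j x y s :
  t_pow e *m frame j x y s = frame j x (if e then - y else y) (if e then - s else s).
Proof. by case: e; rewrite ?t_mx_frame // mul1mx. Qed.

(** With different indices, the change of frame makes the third coordinate large. With equal indices
    and different kinds, the cones themselves suffice. With equal kinds too, either the sign repeats
    or a d-letter follows t. *)
Lemma pingpong k j b e l v :
    ~~ [&& l.1.1 == k, l.1.2%:Z == j, l.2 != b & k || ~~ e] ->
  cone_at k j b v -> cone_at l.1.1 l.1.2 l.2 (gen_mx l *m (t_pow e *m v)).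
Proof.
case: l => [[k' n] b'] /= nocancel [x [y [s [-> cone_v]]]].
rewrite t_pow_frame.
have [j_n|j_n] := eqVneq n%:Z j; last first.
  rewrite (frame_shift j n); set y' := if e then - y else y.
  set P := (j - n%:Z) * y'.
  have yP : `|y'| <= `|P|.
    by rewrite /P normrM ler_peMl // -gtz0_ge1 normr_gt0 subr_eq0 eq_sym.
  case: k' {nocancel}.
    rewrite gen_mxC_frame; eexists _, _, _; split; first reflexivity.
    case: k cone_v => [/andP[near_v _]|/coneD_nearD near_v].
      by apply: coneC_C => //; move: near_v; rewrite /nearC /y'; case: (e); lia.
    by apply: coneD_C; [|by right]; move: near_v; rewrite /nearD /y'; case: (e); lia.
  rewrite gen_mxD_frame; eexists _, _, _; split; first reflexivity.
  case: k cone_v => [/andP[near_v _]|/coneD_nearD near_v].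
    by apply: coneC_D; [|by right]; move: near_v; rewrite /nearC /y'; case: (e); lia.
  by apply: coneD_D => //; move: near_v; rewrite /nearD /y'; case: (e); lia.
subst j; move: nocancel; rewrite eqxx /=.
have frame0 a c d : frame n a c d = frame n a c (d + 100 * 0).
  by rewrite mulr0 addr0.
case: k' => /=.
  case: k cone_v => /= cone_v nocancel; last first.
    rewrite frame0 gen_mxC_frame; eexists _, _, _; split; first reflexivity.
    apply: coneD_C; last by left.
    by move/coneD_nearD: cone_v; rewrite /nearD; case: (e); lia.
  rewrite gen_mxC_frame; eexists _, _, _; split; first reflexivity.
  have -> : b' = b by apply/eqP; move: nocancel; rewrite andbT negbK.
  apply: coneC_id; move: cone_v; rewrite /coneC /nearC /sgn100.
  by case: (b); case: (e); lia.
case: k cone_v => /= cone_v nocancel.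
  rewrite frame0 gen_mxD_frame; eexists _, _, _; split; first reflexivity.
  apply: coneC_D; last by left.
  by case/andP: cone_v => + _; rewrite /nearC; case: (e); lia.
rewrite gen_mxD_frame; eexists _, _, _; split; first reflexivity.
case: e nocancel => /= nocancel; first exact: coneD_opp cone_v.
have -> : b' = b by apply/eqP; move: nocancel; rewrite andbT negbK.
exact: coneD_id.
Qed.

Local Open Scope group_scope.

(** * The Cayley graph and faithfulness of reduced words *)

Definition cay_t (g : 'SL_3[int]) := t_sl * g.
Definition cay_E (a : gen) (g h : 'SL_3[int]) := h = gen_sl (a, true) * g.

Lemma gen_sl_linv l : gen_sl (linv l) * gen_sl l = 1.
Proof. exact/val_inj/gen_mx_linv. Qed.

Lemma edge_cay l g h : edge cay_E l g h <-> h = gen_sl l * g.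
Proof.
case: l => a []; rewrite /edge /cay_E //=; split=> ->.
  by rewrite mulgA (gen_sl_linv (a, true)) mul1g.
by rewrite mulgA (gen_sl_linv (a, false)) mul1g.
Qed.

Lemma vec3_ext (A B : 'M[int]_3) :
  (forall x y z, A *m vec3 x y z = B *m vec3 x y z) -> A = B.
Proof.
move=> AB; have {}AB (v : 'cV_3) : A *m v = B *m v.
  suff -> : v = vec3 (v 0%R 0%R) (v 1%R 0%R) (v (Ordinal (isT : 2 < 3)%N) 0%R) by [].
  by apply/colP => -[[|[|[|]]] //= ?]; rewrite !mxE /=; congr (v _ _); apply/val_inj.
apply/matrixP => i j; have := AB (delta_mx j 0%R).
by rewrite -!colE => /colP/(_ i); rewrite !mxE.
Qed.

Lemma t_sl_sqr : t_sl * t_sl = 1.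
Proof.
apply/val_inj/vec3_ext => x y z /=; rewrite -mulmxA mul1mx.
have -> : vec3 x y z = frame 0 x y z by rewrite /frame mul0r addr0.
by rewrite !t_mx_frame !opprK.
Qed.

Lemma t_sl_commute n b : gen_sl (true, n, b) * t_sl = t_sl * gen_sl (true, n, b).
Proof.
apply/val_inj/vec3_ext => x y z /=; rewrite -!mulmxA.
have -> : vec3 x y z = frame n x y (z - 100 * n%:Z * y) by rewrite /frame subrK.
rewrite t_mx_frame !gen_mxC_frame t_mx_frame; congr frame; ring.
Qed.

Lemma valid_cay : valid cay_t cay_E.
Proof.
split.
- by move=> g; rewrite /cay_t mulgA t_sl_sqr mul1g.
- by move=> a g h h' -> ->.
- by move=> a g g' h -> /mulgI.
- by move=> [a n] g h /= a1 ->; rewrite /cay_E /cay_t !mulgA a1 t_sl_commute.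
Qed.

(** Induction along the word by [pingpong]; the outer [t_pow e] undoes the final power of t. *)
Lemma walk_cay_cone k j b w e g h v :
  ~~ (if w is a :: _ then [&& a.2.1.1 == k, a.2.1.2%:Z == j, a.2.2 != b & k || ~~ a.1]
      else false) ->
  sorted compat w -> walk cay_t cay_E w e g h -> w != [::] ->
  cone_at k j b (slval g *m v) ->
  exists k' n b', cone_at k' (Posz n) b' (t_pow e *m (slval h *m v)).
Proof.
elim: w k j b g => // -[e1 l] w IHw k j b g /= ncan red_w [g' gg' g'h] _ cone_g.
have cone_g' : cone_at l.1.1 l.1.2 l.2 (slval g' *m v).
  move/edge_cay: gg' => ->; rewrite /= -mulmxA.
  have -> : slval (tw cay_t e1 g) = t_pow e1 *m slval g.
    by case: (e1) => /=; rewrite ?mul1mx.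
  by rewrite -mulmxA; apply: pingpong ncan cone_g.
have [w0|w_neq0] := eqVneq w [::].
  exists l.1.1, l.1.2, l.2; move: g'h; rewrite w0 /= => <-.
  have /(congr1 val) /= tt := t_sl_sqr.
  by case: (e) => /=; rewrite ?mul1mx // !mulmxA tt mul1mx.
apply: (IHw l.1.1 l.1.2 l.2 g') => //; last exact: path_sorted red_w.
case: w red_w {IHw g'h w_neq0} => //= a w /andP[+ _].
rewrite /compat /cancels /=; apply: contra => /and4P[/eqP k1 /eqP[n1] b1 ->].
rewrite andbT; apply/eqP; rewrite /linv.
case: (a.2) k1 n1 b1 => [[k' n'] b'] /= -> -> nb; congr (_, _).
  by case: (l.1).
by case: b' (l.2) nb => [] [].
Qed.

Lemma cay_faithful w e : sorted compat w -> walk cay_t cay_E w e 1 1 ->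
  w = [::] /\ e = false.
Proof.
move=> red_w w11.
(* The start vector lies in the cone that the missing generator d_(-1) would have. *)
pose v := frame (- 1) 1 2 1.
have [w0|w_neq0] := eqVneq w [::].
  split=> //; move: w11; rewrite w0; case: e => //= t1.
  move: t1; rewrite /cay_t mulg1 => /(congr1 (fun g => slval g *m v)).
  by rewrite t_mx_frame mul1mx => /vec3_inj[].
have [||k [n [b [x [y [s []]]]]]] := walk_cay_cone (k := false) (j := - 1%:Z)
  (b := true) (v := v) _ red_w w11 w_neq0.
- by case: (w) => // a ?; apply/negP => /and4P[_ + _ _]; lia.
- by rewrite mul1mx; exists 1%R, 2%R, 1%R.
rewrite mul1mx t_pow_frame /frame => /vec3_inj[ex ey ez].
(* In frame [n] the start vector, up to t, is (1, ±2, ∓(199 + 200n)): its third coordinate is too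
   large for either cone. *)
case: k; first by rewrite /coneC /nearC; case: e {w11} ey ez; lia.
by rewrite /coneD; case: e {w11} ey ez; lia.
Qed.

(** * The sharply 2-transitive group *)

Lemma conn_prod_mulr X (t : X -> X) E g h k x y :
  conn (prod_t cay_t t) (prod_E cay_E E) (g, x) (h, y) ->
  conn (prod_t cay_t t) (prod_E cay_E E) (g * k, x) (h * k, y).
Proof.
pose tr (p : 'SL_3[int] * X) := (p.1 * k, p.2).
have tr_conn p q : conn (prod_t cay_t t) (prod_E cay_E E) p q ->
    conn (prod_t cay_t t) (prod_E cay_E E) (tr p) (tr q); last exact: tr_conn.
elim=> [|q' _ pq'|l q' r _ pq' /edge_prod[/edge_cay q'r q'r']].
- exact: conn_refl.
- have -> : tr (prod_t cay_t t q') = prod_t cay_t t (tr q').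
    by rewrite /tr /prod_t /cay_t /= mulgA.
  exact: conn_t.
apply: conn_edge pq' _; apply/edge_prod; split; last exact: q'r'.
by apply/edge_cay; rewrite /= q'r mulgA.
Qed.

Lemma conn_cay_mulr g h k :
  conn cay_t cay_E g h -> conn cay_t cay_E (g * k) (h * k).
Proof.
elim=> [|h' _ gh'|l h' h'' _ gh' /edge_cay ->].
- exact: conn_refl.
- by rewrite /cay_t -mulgA; apply: conn_t.
by rewrite -mulgA; apply: conn_edge gh' _; apply/edge_cay.
Qed.

(** The subgroup generated by t and all c_i, d_j, as the component of 1 in the Cayley graph. *)
Definition gen_group : {pred 'SL_3[int]} := fun g => `[< conn cay_t cay_E 1 g >].

Lemma gen_groupP g : reflect (conn cay_t cay_E 1 g) (g \in gen_group).
Proof. exact: asboolP. Qed.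

Lemma gen_group_closed : group_closed gen_group.
Proof.
split=> [|u v /gen_groupP u1 /gen_groupP v1]; apply/gen_groupP.
  exact: conn_refl.
apply: conn_trans (conn_sym valid_cay _) (conn_cay_mulr v^-1 u1).
by have := conn_cay_mulr v^-1 v1; rewrite mul1g mulgV.
Qed.

Record sharp_group := SharpGroup {
  sgval :> 'SL_3[int];
  _ : sgval \in gen_group }.

HB.instance Definition _ := [isSub for sgval].
HB.instance Definition _ := [Choice of sharp_group by <:].
HB.instance Definition _ :=
  SubChoice_isSubGroup.Build 'SL_3[int] gen_group sharp_group gen_group_closed.

Section Action.
Variable E : gen -> pt -> pt -> Prop.
Hypotheses (V : valid flip E) (sharpE : sharp flip E).
Hypothesis total : forall l x, exists z, edge E l x z.
Hypothesis trans : forall q : pt * pt, q.1 <> q.2 ->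
  conn (prod_t flip flip) (prod_E E E) q (origin, flip origin).

Let connP := conn (prod_t cay_t flip) (prod_E cay_E E).
Let VP := valid_prod valid_cay V.

(** Some word evaluates to [g] and leads from [x] to [y]. *)
Definition acts g x y := connP (1, x) (g, y).

Lemma acts_mul g h x y z : acts h x y -> acts g y z -> acts (g * h) x z.
Proof.
move=> xy yz; have := conn_prod_mulr h yz; rewrite mul1g.
exact: conn_trans.
Qed.

Lemma acts_inv g x y : acts g x y -> acts g^-1 y x.
Proof.
move=> xy; have := conn_prod_mulr g^-1 xy; rewrite mul1g mulgV.
exact: conn_sym.
Qed.

Lemma acts_total g x : g \in gen_group -> exists y, acts g x y.
Proof.
move=> /gen_groupP; elim=> [|h _ [y xy]|l h h' _ [y xy] hh'].
- by exists x; apply: conn_refl.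
- by exists (flip y); apply: conn_t xy.
have [z yz] := total l y; exists z; apply: conn_edge xy _.
by apply/edge_prod; split; [exact: hh' | exact: yz].
Qed.

(** This makes the action well defined: by ping-pong, a reduced word representing 1 is empty. *)
Lemma acts1 x y : acts 1 x y -> x = y.
Proof.
move=> /(conn_walk VP)[w [e [red_w /walk_prod[/= w1]]]].
by have [-> ->] := cay_faithful red_w w1.
Qed.

Lemma acts_fun g x y y' : acts g x y -> acts g x y' -> y = y'.
Proof.
by move=> /acts_inv xy /(acts_mul xy); rewrite mulgV; apply: acts1.
Qed.

(** A word for [g] found at [x] can be followed from [y] by totality and must end at [y], so it
    fixes the pair and is trivial. *)
Lemma acts_sharp g x y : x <> y -> acts g x x -> acts g y y -> g = 1.
Proof.
move=> xy /(conn_walk VP)[w [e [red_w /walk_prod[/= wg wx]]]] yy.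
have [z yz] : exists z, walk flip E w e y z.
  elim: (w) {yy xy} y => [|a v IHv] y; first by eexists.
  have [y' yy'] := total a.2 (tw flip a.1 y).
  by have [z y'z] := IHv y'; exists z, y'.
have /acts_fun/(_ yy) zy : acts g y z.
  by apply: (walk_conn (w := w) (e := e)); apply/walk_prod.
rewrite zy in yz.
have xyw : walk (prod_t flip flip) (prod_E E E) w e (x, y) (x, y).
  exact/walk_prod.
have [w0 e0] := sharp_reduced (p := (x, y)) V flip_free sharpE red_w xy xyw.
by rewrite w0 e0 /= in wg.
Qed.

Lemma conn_acts p q : conn (prod_t flip flip) (prod_E E E) p q ->
  exists2 g, g \in gen_group & acts g p.1 q.1 /\ acts g p.2 q.2.
Proof.
elim=> [|q' _ [g /gen_groupP g1 [pq pq']]|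
        l q' r _ [g /gen_groupP g1 [pq pq']] /edge_prod[q'r q'r']].
- exists 1; first by apply/gen_groupP; apply: conn_refl.
  by split; apply: conn_refl.
- exists (t_sl * g); first by apply/gen_groupP; apply: conn_t g1.
  by split; [apply: conn_t pq | apply: conn_t pq'].
exists (gen_sl l * g).
  by apply/gen_groupP; apply: (conn_edge (l := l)) g1 _; apply/edge_cay.
have gg : edge cay_E l g (gen_sl l * g) by apply/edge_cay.
split; [apply: conn_edge pq _ | apply: conn_edge pq' _]; apply/edge_prod.
  by split; [apply: gg | apply: q'r].
by split; [apply: gg | apply: q'r'].
Qed.

Lemma sharp_group_action : exists act : sharp_group -> pt -> pt,
  sharply_2_transitive_action act /\ forall g x, acts (sgval g) x (act g x).
Proof.
have /choice[f fP] : forall p : sharp_group * pt, exists y, acts (sgval p.1) p.2 y.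
  by move=> [g x]; apply: acts_total; apply: valP g.
pose act g x := f (g, x).
have actP (g : sharp_group) x : acts (sgval g) x (act g x) := fP (g, x).
have actE (g : sharp_group) x y : acts (sgval g) x y -> act g x = y.
  exact: acts_fun (actP g x).
exists act; split=> //; split.
- split=> [x|g h x]; apply: actE; first exact: conn_refl.
  exact: acts_mul (actP h x) (actP g _).
- by exists origin, (flip origin); apply/nesym/flip_free.
move=> x1 x2 y1 y2 x_neq y_neq.
have xy : conn (prod_t flip flip) (prod_E E E) (x1, x2) (y1, y2).
  apply: conn_trans (trans _) (conn_sym (valid_prod V V) (trans _)); exact.
have [g gG [/= g1 g2]] := conn_acts xy.
exists (SharpGroup gG); split; first by split; apply: actE.
move=> h [h1 h2]; apply: val_inj => /=.
have {}h1 : acts (sgval h) x1 y1 by rewrite -h1.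
have {}h2 : acts (sgval h) x2 y2 by rewrite -h2.
have := acts_sharp x_neq (acts_mul g1 (acts_inv h1)) (acts_mul g2 (acts_inv h2)).
by move=> hg; rewrite -[g]mul1g -(mulgV (sgval h)) -mulgA hg mulg1.
Qed.

End Action.

(* A nontrivial abelian normal subgroup N is regular; if n in N sends x to t x
   then t n is an involution or trivial and fixes x, so it is trivial because
   every involution moving a point is conjugate to t. *)
Lemma split_commute (G : groupType) X (act : G -> X -> X) (t : G) :
    sharply_2_transitive_action act -> t * t = 1 -> (forall x, act t x <> x) ->
  split_group G -> forall g, commute t (t ^ g).
Proof.
move=> [[act1 actM] [x0 [y0 xy0]] trans2] tt t_free [N [[N1 ND] NJ NC [a Na a1]]] g.
have fix2 h x y : x <> y -> act h x = x -> act h y = y -> h = 1.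
  move=> xy hx hy; have [k [_ uniq_k]] := trans2 x y x y xy xy.
  by rewrite -(uniq_k h) // -(uniq_k 1).
have moves h : h <> 1 -> exists x, act h x <> x.
  move=> h1; have [hx|?] := pselect (act h x0 = x0); last by exists x0.
  have [hy|?] := pselect (act h y0 = y0); last by exists y0.
  by case: h1; apply: fix2 hx hy.
have actK h x : act h^-1 (act h x) = x by rewrite -actM mulVg act1.
(* Some [k] maps the pair (x, h x) to (x0, t x0), and conjugates [h] accordingly. *)
have conj_act h x : exists k, act h x <> x ->
    act (k * h * k^-1) x0 = act t x0 /\ act k x = x0.
  have [hx|hx] := pselect (act h x = x); first by exists 1.
  have [|k [[kx khx] _]] := trans2 x (act h x) x0 (act t x0) (nesym hx).
    exact/nesym/t_free.
  by exists k => _; split=> //; rewrite -khx -kx !actM actK.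
have conjE (k h : G) : k * h * k^-1 = h ^ k^-1 by rewrite conjgE invgK mulgA.
suff Nt : N t by apply: NC => //; apply: NJ.
have [p ap] := moves a a1.
have [k /(_ ap)[nx _]] := conj_act a p.
move: (NJ _ k^-1 Na) nx; rewrite -conjE; move: (k * a * k^-1) => n Nn nx.
(* The product [m * n] fixes [x0], and also [t x0 = n x0] because it commutes with [n]; hence it is
   1 and [t * n] squares to 1. *)
pose m := t * n * t^-1.
have Nm : N m by rewrite /m conjE; apply: NJ.
have mnx : act (m * n) x0 = x0.
  by rewrite actM nx /m !actM actK nx -actM tt act1.
have mn1 : m * n = 1.
  apply: (fix2 _ _ (act t x0) _ mnx); first exact/nesym/t_free.
  by rewrite -nx -actM (NC _ _ Nm Nn : m * n = n * m) -mulgA actM mnx.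
have tV : t^-1 = t by rewrite -[t^-1]mulg1 -tt mulgA mulVg mul1g.
have tntn : t * n * (t * n) = 1 by rewrite mulgA -mn1 /m tV.
have [tn|tn] := pselect (t * n = 1).
  by suff -> : t = n by []; rewrite -[n]mul1g -tt -mulgA tn mulg1.
(* Otherwise a conjugate [b] of the involution [t * n] swaps [x0] and [t x0], so [b = t]; but [b]
   fixes [h x0], since [t * n] fixes [x0]. *)
have [q tnq] := moves _ tn; have [h /(_ tnq)[hx hq]] := conj_act (t * n) q.
set b := h * (t * n) * h^-1 in hx.
have bx : act b (act t x0) = x0.
  rewrite -hx -actM; suff -> : b * b = 1 by [].
  rewrite /b !mulgA mulgVK -[_ * t * n]mulgA -[h * t * n]mulgA -[h * _ * _]mulgA.
  by rewrite tntn mulg1 mulgV.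
have bt : b = t.
  have tx_neq : x0 <> act t x0 by apply/nesym/t_free.
  have [c [_ uniq_c]] := trans2 _ _ _ _ tx_neq (nesym tx_neq).
  by rewrite -(uniq_c b) // -(uniq_c t) // -actM tt act1.
case: (t_free (act h x0)).
by rewrite -{1}bt /b !actM actK nx -(actM t) tt act1.
Qed.

Theorem theorem1p2 :
  exists (S : {pred 'SL_3[int]}) (G : subGroupType S),
    sharply_2_transitive G /\ ~ split_group G.
Proof.
exists gen_group, sharp_group.
have [E [V sharpE total trans]] := exists_sharp_structure.
have [act [act2 actsE]] := sharp_group_action V sharpE total trans.
split; first by exists pt, act.
pose d := gen_sl (false, 0%N, true).
have tG : t_sl \in gen_group.
  by apply/gen_groupP; rewrite -[t_sl]mulg1; apply/conn_t/conn_refl.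
have dG : d \in gen_group.
  apply/gen_groupP; apply: (conn_edge (l := (false, 0%N, true))) (conn_refl _ _ _) _.
  by apply/edge_cay; rewrite mulg1.
pose t := SharpGroup tG.
have tt : t * t = 1 by apply/val_inj/t_sl_sqr.
have t_free x : act t x <> x.
  have tx : acts E t_sl x (flip x).
    by rewrite -[t_sl]mulg1; apply: (conn_t (y := (1, x))) (conn_refl _ _ _).
  by have -> := acts_fun V (actsE t x) tx; apply: flip_free.
move=> /(split_commute act2 tt t_free)/(_ (SharpGroup dG))/(congr1 val).
rewrite /commute !conjgE /= -/d => tc.
pose l : letter := (false, 0%N, true).
(* With [c = d^-1 * t * d], this reduced word spells [t * c * t * c], which would be 1 if t and [c]
   commuted. *)
pose w := [:: (false, l); (true, linv l); (true, l); (true, linv l)].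
suff : walk cay_t cay_E w true 1 1 by case/cay_faithful.
exists d; first by apply/edge_cay; rewrite mulg1.
have dV : gen_sl (linv l) = d^-1.
  by rewrite -[LHS]mulg1 -(mulgV d) mulgA gen_sl_linv mul1g.
do 3!(eexists; first by apply/edge_cay).
rewrite /= /cay_t dV -/d.
set c := d^-1 * (t_sl * d) in tc *.
have cc : c * c = 1.
  rewrite /c -!mulgA (mulgA d) mulgV mul1g (mulgA t_sl) t_sl_sqr.
  by rewrite mul1g mulVg.
transitivity (t_sl * c * (t_sl * c)); first by rewrite /c !mulgA.
by rewrite {1}tc mulgA -(mulgA c) t_sl_sqr mulg1.
Qed.
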